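(* Let $s,t\in\mathbb{C}$ with $t\neq 0$ and $0<|q|<1$, where $q=\varphi_{s,t}'/\varphi_{s,t}$, and let $u\in\mathbb{C}$. Then, as formal power series in $x$ (hence also as an identity of sums for every $x\in\mathbb{C}$ for which the series converge), $$\sum_{n=0}^{\infty}\genfrac{[}{]}{0pt}{}{2n}{n}_{q}\frac{(-u/t)^{\binom{n}{2}}}{(-\sqrt{q};q)_{n}(-q;q)_{n}(1-q^{2n+1})}\left(\frac{4}{\sqrt{-t\varphi_{s,t}}}\right)^n x^{2n+1}=\frac{x}{1-q}\;{}_{3}\Phi_{2}\left(\begin{array}{c} \sqrt{q},\sqrt{q},-\sqrt{q} \\ q\sqrt{q},-q\sqrt{q} \end{array};q,-\frac{u}{t},\frac{4x^2}{\sqrt{-t\varphi_{s,t}}}\right).$$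
   Context: $\varphi_{s,t}=\frac{s+\sqrt{s^2+4t}}{2}$ and $\varphi_{s,t}'=\frac{s-\sqrt{s^2+4t}}{2}$ (for a fixed choice of the square root), so that $\varphi_{s,t}\varphi_{s,t}'=-t$; $q=\varphi_{s,t}'/\varphi_{s,t}$. Square roots $\sqrt q$ and $\sqrt{-t\varphi_{s,t}}$ are fixed once and for all. $(a;q)_0=1$ and $(a;q)_n=\prod_{k=0}^{n-1}(1-aq^k)$ for $n\ge1$; $(a_1,\dots,a_m;q)_n=(a_1;q)_n\cdots(a_m;q)_n$. The $q$-binomial coefficient is $\genfrac{[}{]}{0pt}{}{n}{k}_{q}=\frac{(q;q)_n}{(q;q)_k(q;q)_{n-k}}$. The deformed basic hypergeometric series is ${}_{r}\Phi_{r'}\left(\begin{array}{c} a_1,\ldots,a_r \\ b_1,\ldots,b_{r'} \end{array};q,v,z\right)=\sum_{n\ge0}v^{\binom n2}\frac{(a_1,\ldots,a_r;q)_n}{(q,b_1,\ldots,b_{r'};q)_n}\bigl[(-1)^nq^{\binom n2}\bigr]^{1+r'-r}z^n$; for $r=r'+1$ the bracketed factor is $1$. Convention: $0^0=1$. *)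

(* Defs.v *)
From HB Require Import structures.
From mathcomp Require Import all_boot all_order all_algebra.
From mathcomp Require Import complex.
From mathcomp Require Import all_classical all_reals all_analysis.

Set Implicit Arguments.
Unset Strict Implicit.
Unset Printing Implicit Defensive.

Import Order.TTheory GRing.Theory Num.Theory.
Import numFieldNormedType.Exports.
Local Open Scope classical_set_scope.
Local Open Scope ring_scope.

(* [d] is the chosen square root of [s ^+ 2 + 4 * t]. *)
Definition phi (K : fieldType) (s d : K) : K := (s + d) / 2.
Definition phi' (K : fieldType) (s d : K) : K := (s - d) / 2.

Definition qpoch (K : fieldType) (a q : K) (n : nat) : K :=
  \prod_(k < n) (1 - a * q ^+ k).

Definition qbinom (K : fieldType) (q : K) (n k : nat) : K :=
  qpoch q q n / (qpoch q q k * qpoch q q (n - k)%N).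

(* The coefficient of z ^ n in the deformed basic hypergeometric series with
   upper parameters [al] and lower parameters [bl]. The exponent 1 + r' - r may
   be negative, hence the integer power [^] (0 ^ 0 = 1 for both [^] and [^+]). *)
Definition dbhs_coef (K : fieldType) (al bl : seq K) (q v : K) (n : nat) : K :=
  v ^+ 'C(n, 2)
  * ((\prod_(a <- al) qpoch a q n)
     / (qpoch q q n * \prod_(b <- bl) qpoch b q n))
  * ((-1) ^+ n * q ^+ 'C(n, 2)) ^ (1 + (size bl)%:Z - (size al)%:Z).

(* For K := R[i] these are convergence and sum of a complex series for the
   topology given by the modulus; [series_sum] is meaningful only under
   [series_cvg]. *)
Definition series_cvg (K : numFieldType) (a : nat -> K) : Prop :=
  cvgn (series a).
Definition series_sum (K : numFieldType) (a : nat -> K) : K :=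
  limn (series a).

Definition dbhs_term (K : fieldType) (al bl : seq K) (q v z : K) (n : nat) : K :=
  dbhs_coef al bl q v n * z ^+ n.
Definition dbhs (K : numFieldType) (al bl : seq K) (q v z : K) : K :=
  series_sum (dbhs_term al bl q v z).

(* A formal power series is its sequence of coefficients. *)
Definition fps (K : Type) : Type := nat -> K.

Definition fps_one (K : fieldType) : fps K := fun n => (n == 0%N)%:R.
Definition fps_X (K : fieldType) : fps K := fun n => (n == 1%N)%:R.
Arguments fps_one {K}.
Arguments fps_X {K}.

Definition fps_scale (K : fieldType) (a : K) (f : fps K) : fps K :=
  fun n => a * f n.
Definition fps_mul (K : fieldType) (f g : fps K) : fps K :=
  fun n => \sum_(i < n.+1) f i * g (n - i)%N.
Definition fps_exp (K : fieldType) (f : fps K) (n : nat) : fps K :=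
  iter n (fps_mul f) fps_one.

(* Infinite sums are taken in the X-adic topology: each coefficient of the
   partial sums is eventually constant, and the sum collects these eventual
   values; [fps_sum] is meaningful only under [fps_summable]. *)
Definition fps_coef_stab (K : fieldType) (F : nat -> fps K) (m : nat) : set K :=
  [set a | \forall N \near \oo, \sum_(n < N) F n m = a].
Definition fps_summable (K : fieldType) (F : nat -> fps K) : Prop :=
  forall m, exists a, fps_coef_stab F m a.
Definition fps_sum (K : fieldType) (F : nat -> fps K) : fps K :=
  fun m => xget 0 (fps_coef_stab F m).

Definition fps_dbhs_term (K : fieldType) (al bl : seq K) (q v : K) (z : fps K)
    (n : nat) : fps K :=
  fps_scale (dbhs_coef al bl q v n) (fps_exp z n).
Definition fps_dbhs (K : fieldType) (al bl : seq K) (q v : K) (z : fps K) :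
    fps K :=
  fps_sum (fps_dbhs_term al bl q v z).

(* Main.v *)
Require Import Defs.
From HB Require Import structures.
From mathcomp Require Import all_boot all_order all_algebra.
From mathcomp Require Import complex.
From mathcomp Require Import ring.
From mathcomp Require Import all_classical all_reals all_analysis.

Set Implicit Arguments.
Unset Strict Implicit.
Unset Printing Implicit Defensive.

Import Order.TTheory GRing.Theory Num.Theory.
Import numFieldNormedType.Exports.
Local Open Scope classical_set_scope.
Local Open Scope ring_scope.
Local Open Scope complex_scope.

(** Both sides are series in the same powers of [x], and they agree term by
    term.  Since [(1 - sq * y) * (1 + sq * y) = 1 - q * y ^+ 2] when
    [sq ^+ 2 = q], splitting the factors of [(q; q)_(2n)] by the parity of the
    exponent gives (lemma [qpoch_double])
      [(q; q)_(2n) = (sq; q)_n (- sq; q)_n (q; q)_n (- q; q)_n],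
    so the left coefficient collapses to
    [(sq; q)_n / ((q; q)_n (1 - q ^+ (2n + 1)))].
    On the right, [(a; q)_n / (a q; q)_n] telescopes to
    [(1 - a) / (1 - a q ^+ n)] (lemma [qpoch_shift]); the two quotients
    [a = sq] and [a = - sq] multiply to [(1 - q) / (1 - q ^+ (2n + 1))], and
    the prefactor [x / (1 - q)] cancels [1 - q].  No denominator vanishes,
    because [`|q| < 1] keeps the positive powers of [q] away from [1]. This is
    lemma [coef_eq].

    Two facts then transfer the equality of terms to the sums.  In the formal
    setting, multiplication by a fixed power series commutes with a locally
    finite sum (lemma [fps_sum_mull]).  In the analytic setting, the left
    series is the right one scaled by [x / (1 - q)]; a nonzero factor does not
    change convergence, and at [x = 0] both series have only finitely many
    nonzero terms. *)

(** * Shifted factorials *)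

Lemma qpochS (K : fieldType) (a q : K) n :
  qpoch a q n.+1 = qpoch a q n * (1 - a * q ^+ n).
Proof. by rewrite /qpoch big_ord_recr. Qed.

(** Both sides are [qpoch a q n.+1], with the first or the last factor
    split off. *)
Lemma qpoch_shift (K : fieldType) (a q : K) n :
  (1 - a) * qpoch (q * a) q n = qpoch a q n * (1 - a * q ^+ n).
Proof.
rewrite -qpochS /qpoch big_ord_recl expr0 mulr1; congr (_ * _).
by apply: eq_bigr => i _; rewrite exprS mulrCA mulrA.
Qed.

Lemma qpoch_neq0 (K : fieldType) (a q : K) n :
  (forall k, a * q ^+ k != 1) -> qpoch a q n != 0.
Proof. by move=> h; apply/prodf_neq0 => i _; rewrite subr_eq0 eq_sym. Qed.

(** The factors with an even, resp. odd, power of [q] in [qpoch q q (2 * n)]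
    are [1 - r ^+ 2 * (q ^+ k) ^+ 2], resp. [1 - q ^+ 2 * (q ^+ k) ^+ 2], and
    these are differences of squares. *)
Lemma qpoch_double (K : fieldType) (r q : K) n : r ^+ 2 = q ->
  qpoch q q (2 * n) =
  qpoch r q n * qpoch (- r) q n * qpoch q q n * qpoch (- q) q n.
Proof.
move=> rq; elim: n => [|n IHn]; first by rewrite /qpoch !big_ord0 !mulr1.
rewrite mulnS add2n !qpochS IHn exprS mulnC exprM -rq; ring.
Qed.

(** A vanishing factor [1 - a * q ^+ k] would make the square
    [a ^+ 2 * q ^+ (2 * k)] equal to [1]; as [a ^+ 2] is a positive power of
    [q], that is excluded when [q] is not a root of unity. *)
Lemma qpoch_sqr_neq0 (K : fieldType) (a q : K) m n :
  (forall k, q ^+ k.+1 != 1) -> a ^+ 2 = q ^+ m.+1 -> qpoch a q n != 0.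
Proof.
move=> q1 am; apply: qpoch_neq0 => k; apply/eqP => /(congr1 (fun y => y ^+ 2)).
rewrite exprMn am -exprM -exprD addSn expr1n; exact/eqP/q1.
Qed.

(** The value of both sides is
    [v ^+ 'C(n, 2) * qpoch r q n / (qpoch q q n * (1 - q ^+ (2 * n + 1)))]: the
    left one by [qpoch_double], the right one by [qpoch_shift] at [r] and
    [- r]. With three upper and two lower parameters the factor in
    [(-1) ^+ n * q ^+ 'C(n, 2)] has exponent [0]. *)
Lemma coef_eq (K : fieldType) (q r v : K) n :
  (forall k, q ^+ k.+1 != 1) -> r ^+ 2 = q ->
  qbinom q (2 * n) n
    * (v ^+ 'C(n, 2)
       / (qpoch (- r) q n * qpoch (- q) q n * (1 - q ^+ (2 * n + 1))))
  = (1 - q)^-1 * dbhs_coef [:: r; r; - r] [:: q * r; - q * r] q v n.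
Proof.
move=> q1 rq.
have Nrq : (- r) ^+ 2 = q by rewrite sqrrN.
have r0 : qpoch r q n != 0 by apply: (@qpoch_sqr_neq0 _ _ _ 0).
have Nr0 : qpoch (- r) q n != 0 by apply: (@qpoch_sqr_neq0 _ _ _ 0).
have q0 : qpoch q q n != 0 by apply: (@qpoch_sqr_neq0 _ _ _ 1).
have Nq0 : qpoch (- q) q n != 0 by apply: (@qpoch_sqr_neq0 _ _ _ 1); rewrite ?sqrrN.
have qr0 : qpoch (q * r) q n != 0.
  by apply: (@qpoch_sqr_neq0 _ _ _ 2); rewrite // exprMn rq -exprSr.
have Nqr0 : qpoch (q * - r) q n != 0.
  by apply: (@qpoch_sqr_neq0 _ _ _ 2); rewrite // exprMn Nrq -exprSr.
have e1 : 1 - q != 0 by rewrite subr_eq0 eq_sym (q1 0).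
have en : 1 - q ^+ (2 * n + 1) != 0 by rewrite subr_eq0 eq_sym addn1 q1.
(* The two telescoping quotients, multiplied together. *)
have shift2 : (1 - q) * (qpoch (q * r) q n * qpoch (q * - r) q n) =
    qpoch r q n * qpoch (- r) q n * (1 - q ^+ (2 * n + 1)).
  have -> : 1 - q ^+ (2 * n + 1) = (1 - r * q ^+ n) * (1 - - r * q ^+ n).
    by rewrite addn1 exprS mulnC exprM -{1}rq; ring.
  rewrite [RHS]mulrACA -!qpoch_shift -{1}rq; ring.
rewrite /dbhs_coef /qbinom (qpoch_double _ rq) mul2n -addnn addnK addnn -mul2n.
rewrite !big_cons !big_nil /= expr0z !mulr1 mulNr -mulrN.
have -> : 1 - q ^+ (2 * n + 1) =
    (1 - q) * (qpoch (q * r) q n * qpoch (q * - r) q n)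
    / (qpoch r q n * qpoch (- r) q n).
  by rewrite shift2; field; rewrite Nr0.
by field; rewrite ?r0 ?Nr0 ?q0 ?Nq0 ?qr0 ?Nqr0 ?e1.
Qed.

(** * Formal power series *)

Definition fps_monom (K : fieldType) (a : K) (k : nat) : fps K :=
  fun n => a *+ (n == k).

Lemma fps_scale_monom (K : fieldType) (a b : K) k :
  fps_scale a (fps_monom b k) = fps_monom (a * b) k.
Proof. by apply/funext => n; rewrite /fps_scale /fps_monom mulrnAr. Qed.

Lemma fps_mul_monom (K : fieldType) (a b : K) j k :
  fps_mul (fps_monom a j) (fps_monom b k) = fps_monom (a * b) (j + k).
Proof.
apply/funext => n; rewrite /fps_mul /fps_monom.
have [jn|nj] := leqP j n; last first.
  rewrite big1 => [|i _]; last first.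
    by rewrite (ltn_eqF (leq_ltn_trans (leq_ord i) nj)) mul0r.
  by rewrite (ltn_eqF (leq_trans nj (leq_addr _ _))).
rewrite (bigD1 (Ordinal (n := n.+1) (m := j) jn)) //= eqxx big1 => [|i ij].
  by rewrite addr0 mulrnAr -(eqn_add2l j (n - j)) subnKC.
by rewrite (_ : (i == j :> nat) = false) ?mul0r //; apply: negbTE.
Qed.

Lemma fps_exp_monom (K : fieldType) (a : K) k n :
  fps_exp (fps_monom a k) n = fps_monom (a ^+ n) (k * n).
Proof.
elim: n => [|n IHn]; first by rewrite muln0; apply/funext.
by rewrite /fps_exp iterS [iter _ _ _]IHn fps_mul_monom -exprS mulnS.
Qed.

Lemma fps_X_monom (K : fieldType) : @fps_X K = fps_monom 1 1.
Proof. by []. Qed.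

(** The order of the [n]-th series is at least [n]: this makes the family
    summable, with an explicit bound on the terms that reach degree [m]. *)
Definition fps_small (K : fieldType) (F : nat -> fps K) : Prop :=
  forall n m, (m < n)%N -> F n m = 0.

Lemma fps_small_psum (K : fieldType) (F : nat -> fps K) m N :
  fps_small F -> (m < N)%N ->
  \sum_(n < N) F n m = \sum_(n < m.+1) F n m.
Proof.
move=> F0 mN.
rewrite -!(big_mkord xpredT (fun n => F n m)) (big_cat_nat (leq0n _) mN) //=.
rewrite [X in _ + X]big_nat [X in _ + X]big1 ?addr0 // => n /andP[mn _].
exact: F0.
Qed.

Lemma fps_small_stab (K : fieldType) (F : nat -> fps K) m :
  fps_small F -> fps_coef_stab F m (\sum_(n < m.+1) F n m).
Proof. by move=> F0; exists m.+1 => // N /= mN; apply: fps_small_psum. Qed.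

Lemma fps_small_summable (K : fieldType) (F : nat -> fps K) :
  fps_small F -> fps_summable F.
Proof. by move=> F0 m; eexists; apply: fps_small_stab. Qed.

Lemma fps_sum_small (K : fieldType) (F : nat -> fps K) m :
  fps_small F -> fps_sum F m = \sum_(n < m.+1) F n m.
Proof.
move=> F0; apply: xget_unique; first exact: fps_small_stab.
(* Two eventual values of the same partial sums are compared at a common
   large index. *)
move=> a [N _ aN]; rewrite -(aN (maxn N m.+1)) /= ?leq_maxl //.
by rewrite fps_small_psum // leq_maxr.
Qed.

Lemma fps_sum_mull (K : fieldType) (g : fps K) (F : nat -> fps K) :
  fps_small F -> fps_sum (fun n => fps_mul g (F n)) = fps_mul g (fps_sum F).
Proof.
move=> F0; apply/funext => m.
rewrite fps_sum_small => [|n k kn]; last first.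
  by apply: big1 => i _; rewrite F0 ?mulr0 // (leq_ltn_trans (leq_subr _ _)).
rewrite exchange_big; apply: eq_bigr => i _ /=.
by rewrite -mulr_sumr fps_small_psum ?fps_sum_small // ltnS leq_subr.
Qed.

(** * Series of numbers *)

Lemma series_cvg_scale (K : numFieldType) (c : K) (a : nat -> K) :
  series_cvg a -> series_cvg (fun n => c * a n).
Proof. exact: is_cvg_seriesZ. Qed.

Lemma series_sum_scale (K : numFieldType) (c : K) (a : nat -> K) :
  series_cvg a -> series_sum (fun n => c * a n) = c * series_sum a.
Proof. exact: lim_seriesZ. Qed.

Lemma series_cvg_finite (K : numFieldType) (a : nat -> K) N :
  (forall n, (N <= n)%N -> a n = 0) -> series_cvg a.
Proof.
move=> a0; apply/cvg_ex; exists (series a N).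
apply: cvg_near_cst; exists N => // n /= Nn.
rewrite /series /= (big_cat_nat (leq0n _) Nn) //= [X in _ + X]big_nat.
by rewrite [X in _ + X]big1 ?addr0 // => k /andP[Nk _]; apply: a0.
Qed.

(** * Comparison of the two series *)

Theorem theorem11 (R : realType) (s t u d q sq w : R[i])
    (ht : t != 0)
    (hd : d ^+ 2 = s ^+ 2 + 4 * t)
    (hq : q = phi' s d / phi s d)
    (hq01 : 0 < `|q| < 1)
    (hsq : sq ^+ 2 = q)
    (hw : w ^+ 2 = - t * phi s d) :
  let lhs_coef (n : nat) : R[i] :=
    qbinom q (2 * n) n
    * ((- u / t) ^+ 'C(n, 2)
       / (qpoch (- sq) q n * qpoch (- q) q n * (1 - q ^+ (2 * n + 1))))
    * (4 / w) ^+ n in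
  let al := [:: sq; sq; - sq] in
  let bl := [:: q * sq; - q * sq] in
  let v := - u / t in
  (* identity of formal power series in X *)
  (let lhs_term (n : nat) : fps R[i] :=
     fps_scale (lhs_coef n) (fps_exp fps_X (2 * n + 1)) in
   let z : fps R[i] := fps_scale (4 / w) (fps_exp fps_X 2) in
   [/\ fps_summable lhs_term,
       fps_summable (fps_dbhs_term al bl q v z)
     & fps_sum lhs_term
       = fps_mul (fps_scale (1 - q)^-1 fps_X) (fps_dbhs al bl q v z)])
  /\
  (* identity of sums at every x at which the series converge *)
  (forall x : R[i],
     let lhs_term (n : nat) : R[i] := lhs_coef n * x ^+ (2 * n + 1) in
     let z := 4 * x ^+ 2 / w in
     (series_cvg lhs_term <-> series_cvg (dbhs_term al bl q v z)) /\
     (series_cvg lhs_term ->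
      series_sum lhs_term = x / (1 - q) * dbhs al bl q v z)).
Proof.
have q1 k : q ^+ k.+1 != 1.
  apply/eqP => /(congr1 Num.norm); rewrite normrX normr1 => qk.
  have := exprn_ilt1 k.+1 (normr_ge0 q) (andP hq01).2.
  by rewrite qk ltxx.
move=> lhs_coef al bl v.
have lhsE n : lhs_coef n = (1 - q)^-1 * dbhs_coef al bl q v n * (4 / w) ^+ n.
  by rewrite /lhs_coef coef_eq.
split=> [lhs_term z|x lhs_term z].
  have rhsE n : fps_dbhs_term al bl q v z n =
      fps_monom (dbhs_coef al bl q v n * (4 / w) ^+ n) (2 * n).
    rewrite /fps_dbhs_term /z fps_X_monom fps_exp_monom fps_scale_monom.
    by rewrite fps_exp_monom fps_scale_monom expr1n mulr1 mul1n.
  have rhs_small : fps_small (fps_dbhs_term al bl q v z).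
    move=> n m mn; rewrite rhsE /fps_monom ltn_eqF //.
    by rewrite (leq_trans mn) // leq_pmull.
  have lhs_termE n : lhs_term n =
      fps_mul (fps_scale (1 - q)^-1 fps_X) (fps_dbhs_term al bl q v z n).
    rewrite rhsE /lhs_term fps_X_monom fps_exp_monom !fps_scale_monom.
    by rewrite fps_mul_monom expr1n !mulr1 mul1n addnC lhsE mulrA.
  split.
  - apply: fps_small_summable => n m mn.
    rewrite /lhs_term fps_X_monom fps_exp_monom fps_scale_monom /fps_monom.
    by rewrite mul1n ltn_eqF // addn1 ltnS (leq_trans (ltnW mn)) // leq_pmull.
  - exact: fps_small_summable.
  - by rewrite -fps_sum_mull //; congr fps_sum; apply/funext.
have lhs_termE : lhs_term = fun n => x / (1 - q) * dbhs_term al bl q v z n.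
  apply/funext => n; rewrite /lhs_term /dbhs_term lhsE /z (mulrAC 4).
  rewrite [(4 / w * _) ^+ n]exprMn -exprM exprD expr1.
  by rewrite [LHS]mulrA [LHS]mulrC !mulrA.
have rhs_cvg : series_cvg lhs_term -> series_cvg (dbhs_term al bl q v z).
  have [x0 _|x0 lhs_cvg] := eqVneq x 0.
    apply: (@series_cvg_finite _ _ 1) => -[//|n] _.
    by rewrite /dbhs_term /z x0 expr0n mulr0 mul0r expr0n mulr0.
  have c0 : x / (1 - q) != 0.
    by rewrite mulf_neq0 // invr_eq0 subr_eq0 eq_sym (q1 0).
  have -> : dbhs_term al bl q v z = fun n => (x / (1 - q))^-1 * lhs_term n.
    by apply/funext => n; rewrite lhs_termE mulKf.
  exact: series_cvg_scale.
split=> [|lhs_cvg].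
  by split=> [//|]; rewrite lhs_termE; apply: series_cvg_scale.
by rewrite lhs_termE (series_sum_scale _ (rhs_cvg lhs_cvg)).
Qed.
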